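(* Let $G$ be a finite group. Then $\gamma(G)\in\mathbb{Z}$ and $\gamma(G)=h(G)^2c(G)$. Therefore, $h(G)\in\mathbb{Z}$ if and only if $c(G)$ divides $\gamma(G)$.
   Context: Let $G$ be a finite group, $K_1,\dots,K_s$ its conjugacy classes, $g_i\in K_i$ representatives, and $\chi_1,\dots,\chi_s$ its irreducible complex characters. Harada's number of $G$ is $h(G)=\frac{|K_1|\cdots|K_s|}{\chi_1(1)\cdots\chi_s(1)}$. Put $c(G)=\prod_{i=1}^s|C_G(g_i)|$, where $C_G(g_i)$ is the centralizer of $g_i$ in $G$. The group algebra $\mathbb{C}G$ has basis $\{[g]\mid g\in G\}$ with $[g][h]=[gh]$; for $S\subset G$ write $[S]=\sum_{g\in S}[g]$. Let $Z(\mathbb{C}G)$ be the center of $\mathbb{C}G$. Define $\overline{\,\cdot\,}:\mathbb{C}G\to\mathbb{C}G$ by $\overline{\sum_{g}c_g[g]}=\sum_g\overline{c_g}[g^{-1}]$. On $Z(\mathbb{C}G)$ consider the Hermitian form $\langle u|v\rangle=\mathrm{tr}_{Z(\mathbb{C}G)}(\overline{u}v)$, where $\mathrm{tr}_{Z(\mathbb{C}G)}(u)$ is the trace of the linear map $w\mapsto uw$ on $Z(\mathbb{C}G)$. For a finite (ordered) set $\mathcal{B}$ of vectors of $Z(\mathbb{C}G)$ put $\gamma(\mathcal{B})=|\det(\langle u|v\rangle)_{u,v\in\mathcal{B}}|$, the absolute value of the Gramian determinant. Finally $\gamma(G)=\gamma(\{[K_1],\dots,[K_s]\})$. *)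

(* Defs.v *)
From mathcomp Require Import all_boot all_order all_algebra all_fingroup.
From mathcomp Require Import all_solvable all_field all_character.

Set Implicit Arguments.
Unset Strict Implicit.
Unset Printing Implicit Defensive.

Import GroupScope Order.TTheory GRing.Theory Num.Theory.
Local Open Scope ring_scope.

(* The complex numbers are algC, the field in which the irreducible characters
   'chi[G]_i take their values.  The group algebra CG is group_ring algC G: its
   elements are the #|G| x #|G| matrices A with (A \in group_ring algC G)%MS,
   the basis vector [g] is regular_repr algC G g, the product is *m, and [S]
   is gset_mx algC G S. *)

Section Harada.

Variables (gT : finGroupType) (G : {group gT}).

Definition harada_number : algC :=
  (\prod_(K in classes G) #|K|%:R) / (\prod_(i : Iirr G) 'chi_i 1%g).

Definition centralizer_product : nat :=
  (\prod_(K in classes G) #|'C_G[repr K]|)%N.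

(* The coefficient c_g is read off the row of u at the identity, since the row
   of [g] at the identity is the basis row vector of index g; see
   group_ring_barE. *)
Definition group_ring_bar (u : 'M[algC]_#|G|) : 'M[algC]_#|G| :=
  \sum_(g in G)
     (gring_row u 0 (gring_index G g))^* *: regular_repr algC G g^-1%g.

(* lin_mulmx u is the matrix of w |-> u *m w on row vectors mxvec w, and
   restrictmx Z is its restriction, in the basis row_base Z, to the subspace Z;
   this is meaningful when u lies in group_ring algC G and centralizes it. *)
Definition center_trace (u : 'M[algC]_#|G|) : algC :=
  \tr (restrictmx 'Z(group_ring algC G)%MS (lin_mulmx u)).

Definition center_form (u v : 'M[algC]_#|G|) : algC :=
  center_trace (group_ring_bar u *m v).

Definition gram_abs_det n (B : 'I_n -> 'M[algC]_#|G|) : algC :=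
  `|\det (\matrix_(i, j) center_form (B i) (B j))|.

Definition class_gamma : algC :=
  gram_abs_det (fun i : 'I_#|classes G| => gset_mx algC G (enum_val i)).

Lemma group_ring_barE (c : gT -> algC) :
  group_ring_bar (\sum_(g in G) c g *: regular_repr algC G g) =
  \sum_(g in G) (c g)^* *: regular_repr algC G g^-1%g.
Proof.
apply: eq_bigr => g Gg; congr (_^* *: _).
rewrite [gring_row _]linear_sum summxE (bigD1 g) //= linearZ /= big1 ?addr0.
  by rewrite !mxE gring_indexK // mul1g !eqxx mulr1.
move=> h /andP[Gh /negPf neq_hg]; rewrite linearZ /= !mxE gring_indexK // mul1g.
rewrite eqxx /= (can_in_eq (gring_indexK (G := G))) // eq_sym neq_hg.
by rewrite mulr0.
Qed.

End Harada.

(* Main.v *)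
Require Import Defs.
From mathcomp Require Import all_boot all_order all_algebra all_fingroup.
From mathcomp Require Import all_solvable all_field all_character.
Import GRing.Theory Num.Theory.
Set Implicit Arguments.
Unset Strict Implicit.
Unset Printing Implicit Defensive.
Local Open Scope ring_scope.

(** The central characters 'omega_i are ring morphisms from the center
    Z = 'Z(group_ring algC G) to algC.  Let W be their table of values on the
    class sums, W i j = 'omega_i[K_j] = |K_j| 'chi_i(g_j) / 'chi_i(1).

    The class sums form a basis of Z, and W is invertible; so, in that basis,
    W diagonalizes multiplication by any v in Z, with eigenvalues the
    'omega_i[v], and tr v = sum_i 'omega_i[v] (center_traceE).  The bar
    involution maps the class sum of K to that of K^-1, on which 'omega_i takes
    the conjugate value (gring_irr_mode_gset_inv).  Hence the Gram matrix of the
    class sums is W^* W, and gamma(G) = |det W|^2 (class_gammaE).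

    On the other hand W is the character table X with its rows divided by the
    degrees 'chi_i(1) and its columns multiplied by the class sizes, so that
    det W = h(G) det X (det_mode_table), while column orthogonality of X gives
    |det X|^2 = c(G) (normr_det_character_table).  As h(G) is real, this yields
    gamma(G) = h(G)^2 c(G).

    Integrality: the entries of W are algebraic integers, hence so is
    |det W|^2 = det W * (det W)^*; the formula just obtained shows that it is
    rational, so it is an integer.  Finally c(G) is nonzero, and if
    gamma(G) = q c(G) then h(G) is a rational root of 'X^2 - q, hence an
    integer. *)

(** The trace of an endomorphism of V can be computed in any basis.  The two
    bases C and row_base V have sizes m and \rank V that are equal but not
    syntactically so; the change of basis is therefore a pair of mutually inverse
    rectangular matrices, and mxtrace_mulC replaces conjugation. *)
Lemma mxtrace_restrictmx_basis (F : fieldType) m p n (C : 'M[F]_(m, n))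
    (V : 'M_(p, n)) (f : 'M_n) (A : 'M_m) :
    row_free C -> (C :=: V)%MS -> C *m f = A *m C ->
  \tr (restrictmx V f) = \tr A.
Proof.
move=> freeC eqCV CfA; set B := row_base V.
have eqBC : (B :=: C)%MS := eqmx_trans (eq_row_base V) (eqmx_sym eqCV).
have defB : B = B *m pinvmx C *m C by rewrite mulmxKpV // eqBC.
have defC : C = C *m pinvmx B *m B by rewrite mulmxKpV // eqBC.
have QP1 : C *m pinvmx B *m (B *m pinvmx C) = 1%:M.
  by apply: (row_free_inj freeC); rewrite /= mul1mx -mulmxA -defB -defC.
have -> : restrictmx V f = B *m pinvmx C *m A *m (C *m pinvmx B).
  rewrite (mulmxA _ C) -(mulmxA _ A) -CfA (mulmxA _ C) -defB.
  by rewrite /conjmx mulmxA.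
by rewrite -mulmxA mxtrace_mulC -mulmxA QP1 mulmx1.
Qed.

Lemma gset_mx_class_central (F : fieldType) (gT : finGroupType)
    (G : {group gT}) (K : {set gT}) :
  K \in classes G -> (gset_mx F G K \in 'Z(group_ring F G))%MS.
Proof.
move=> KG; have := gring_class_sum_central F (enum_rank_in KG K).
by rewrite /gring_class_sum enum_rankK_in.
Qed.

Lemma center_group_ringM (F : fieldType) (gT : finGroupType) (G : {group gT})
    (A B : 'M[F]_#|G|) :
    (A \in 'Z(group_ring F G))%MS -> (B \in 'Z(group_ring F G))%MS ->
  (A *m B \in 'Z(group_ring F G))%MS.
Proof.
move=> /center_mxP[RA cA] /center_mxP[RB cB].
apply/center_mxP; split=> [|C RC]; first exact: envelop_mxM.
by rewrite mulmxA cA // -!mulmxA cB.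
Qed.

(** The coefficients of [K] are 0 or 1, so that conjugation fixes them and only
    the inversion of the basis elements remains. *)
Lemma group_ring_bar_gset_mx (gT : finGroupType) (G : {group gT})
    (K : {set gT}) :
  K \subset G -> group_ring_bar (gset_mx algC G K) = gset_mx algC G K^-1%g.
Proof.
move=> sKG; have indicE (c : algC) (X : gT -> 'M[algC]_#|G|) :
    \sum_(g in G) (if g \in K then c else 0) *: X g = \sum_(g in K) c *: X g.
  rewrite [RHS](eq_bigl (fun g => (g \in G) && (g \in K))) => [|g]; last first.
    by rewrite andb_idl //; apply: (subsetP sKG).
  by rewrite big_mkcondr; apply: eq_bigr => g _; case: ifP; rewrite ?scale0r.
have -> : gset_mx algC G K =
    \sum_(g in G) (if g \in K then 1 else 0) *: regular_repr algC G g.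
  by rewrite indicE; apply: eq_bigr => g _; rewrite scale1r.
rewrite group_ring_barE.
under eq_bigr => g _ do rewrite (fun_if Num.conj) conjC1 conjC0.
rewrite indicE /gset_mx [RHS](reindex_inj invg_inj) /=.
by apply: eq_big => [g | g _]; rewrite ?inE ?invgK ?scale1r.
Qed.

(** This is 'chi_i(g^-1) = ('chi_i(g))^*, summed over K; the degree 'chi_i(1) in
    the denominator is real. *)
Lemma gring_irr_mode_gset_inv (gT : finGroupType) (G : {group gT}) (i : Iirr G)
    (K : {set gT}) :
  K \subset G ->
  'omega_i[gset_mx algC G K^-1%g] = ('omega_i[gset_mx algC G K])^*.
Proof.
move=> sKG; rewrite /gset_mx !raddf_sum /= (reindex_inj invg_inj) /=.
rewrite (eq_bigl [in K]) => [|g]; last by rewrite inE invgK.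
apply: eq_bigr => g /(subsetP sKG) Gg.
rewrite !xcfunG ?groupV // unlock !cfunE irr_inv rmorphM /=.
by rewrite [_^-1^*]geC0_conj // invr_ge0 char1_ge0 ?irr_char.
Qed.

(** The matrix W of the values of the central characters on the class sums.
    Classes are indexed by Iirr G through irr_class, as in character_table, so
    that W is square and its determinant makes sense. *)
Definition mode_table (gT : finGroupType) (G : {group gT}) :
  'M[algC]_(Nirr G) :=
  \matrix_(i, j) 'omega_i[gset_mx algC G (irr_class j)].

Lemma mode_tableE (gT : finGroupType) (G : {group gT}) :
  mode_table G = diag_mx (\row_i ('chi[G]_i 1%g)^-1) *m character_table G
                   *m diag_mx (\row_j #|@irr_class gT G j|%:R).
Proof.
apply/matrixP=> i j; rewrite mul_mx_diag mul_diag_mx !mxE.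
have := @gring_mode_class_sum_eq _ G i (cast_ord (NirrE G) j).
rewrite /gring_class_sum -/(irr_class j) => /(_ (repr (irr_class j))) ->.
  by rewrite repr_irr_classK mulrC (mulrC _%:R) mulrA.
exact: mem_repr_classes (irr_classP j).
Qed.

Lemma det_mode_table (gT : finGroupType) (G : {group gT}) :
  \det (mode_table G) = harada_number G * \det (character_table G).
Proof.
rewrite mode_tableE !det_mulmx !det_diag /harada_number reindex_irr_class /=.
under eq_bigr do rewrite mxE; rewrite prodfV.
under [X in _ * X = _]eq_bigr do rewrite mxE.
by rewrite mulrC mulrA.
Qed.

(** Column orthogonality says that X^T times the conjugate of X is the diagonal
    matrix of the centralizer orders. *)
Lemma normr_det_character_table (gT : finGroupType) (G : {group gT}) :
  `|\det (character_table G)| ^+ 2 = (centralizer_product G)%:R.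
Proof.
set X := character_table G.
have XX : X^T *m map_mx Num.conj X =
    diag_mx (\row_j #|'C_G[repr (@irr_class gT G j)]%g|%:R).
  apply/matrixP=> j k; rewrite !mxE.
  under eq_bigr do rewrite !mxE.
  have Gk : repr (irr_class k) \in G.
    by have [] := repr_classesP (irr_classP k).
  rewrite second_orthogonality_relation //; congr (_ *+ nat_of_bool _).
  apply/idP/eqP => [/class_eqP | ->]; last exact: class_refl.
  by rewrite !repr_irr_classK => /(can_inj irr_classK).
rewrite normCK -det_map_mx -[\det X]det_tr -det_mulmx XX det_diag.
rewrite /centralizer_product reindex_irr_class natr_prod.
by apply: eq_bigr => j _; rewrite mxE.
Qed.

Lemma harada_number_neq0 (gT : finGroupType) (G : {group gT}) :
  harada_number G != 0.
Proof.
rewrite mulf_neq0 ?invr_eq0 //; apply/prodf_neq0 => x; last first.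
  by rewrite irr1_neq0.
by move=> /imsetP[g _ ->]; rewrite pnatr_eq0 -lt0n (cardD1 g) class_refl.
Qed.

Lemma harada_number_rat (gT : finGroupType) (G : {group gT}) :
  harada_number G \in Crat.
Proof.
rewrite rpred_div ?rpred_prod // => i _; first exact: rpred_nat.
by apply: rpred_nat_num; rewrite Cnat_irr1.
Qed.

Lemma mode_table_unit (gT : finGroupType) (G : {group gT}) :
  mode_table G \in unitmx.
Proof.
rewrite unitmxE det_mode_table unitfE mulf_neq0 ?harada_number_neq0 //.
by rewrite -unitfE -unitmxE character_table_unit.
Qed.

(** Since 'omega_i is multiplicative on the center, evaluating it on v K_j shows
    that the columns of W^T are eigenvectors, for the eigenvalues 'omega_i[v], of
    the matrix of multiplication by v in the basis of class sums. *)
Lemma center_traceE (gT : finGroupType) (G : {group gT}) (v : 'M_#|G|) :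
    (v \in 'Z(group_ring algC G))%MS ->
  center_trace v = \sum_i 'omega_i[v].
Proof.
move=> Zv; pose K (j : Iirr G) := gset_mx algC G (irr_class j).
have ZK j : (K j \in 'Z(group_ring algC G))%MS.
  exact/gset_mx_class_central/irr_classP.
pose C := \matrix_(j < Nirr G) mxvec (K j).
(* Right multiplication by W^T evaluates every central character on a linear
   combination of class sums: this is both how independence of the class sums
   follows from invertibility of W and how the eigenvalues are found. *)
have modeC m (A : 'M_(m, Nirr G)) j i :
    (A *m (mode_table G)^T) j i = 'omega_i[vec_mx (row j (A *m C))].
  rewrite row_mul mulmx_sum_row linear_sum raddf_sum mxE.
  apply: eq_bigr => k _.
  by rewrite rowK linearZ /= mxvecK xcfunZr !mxE.
have freeC : row_free C.
  apply: inj_row_free => w wC0.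
  apply: (row_free_inj (A := (mode_table G)^T)).
    by rewrite row_free_unit unitmx_tr mode_table_unit.
  by apply/matrixP=> j i; rewrite modeC wC0 mul0mx linear0 linear0 raddf0 mxE.
have sCZ : (C <= 'Z(group_ring algC G))%MS.
  by apply/row_subP => j; rewrite rowK.
have eqCZ : (C :=: 'Z(group_ring algC G))%MS.
  apply/eqmxP; rewrite sCZ -(geq_leqif (mxrank_leqif_sup sCZ)).
  rewrite (eqnP freeC) NirrE -classg_base_center.
  by rewrite rank_leq_row.
have [A defA] : exists A, C *m lin_mulmx v = A *m C.
  apply/submxP/row_subP => j.
  rewrite row_mul rowK mul_vec_lin /= eqCZ.
  exact: center_group_ringM.
rewrite /center_trace (mxtrace_restrictmx_basis freeC eqCZ defA).
have AO : A *m (mode_table G)^T =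
    (mode_table G)^T *m diag_mx (\row_i 'omega_i[v]).
  apply/matrixP => j i.
  rewrite modeC -defA row_mul rowK mul_vec_lin mxvecK /=.
  by rewrite gring_irr_modeM // mul_mx_diag !mxE mulrC.
have uO : (mode_table G)^T \in unitmx by rewrite unitmx_tr mode_table_unit.
rewrite -[A](mulmxK uO) AO -mulmxA mxtrace_mulC -mulmxA mulVmx // mulmx1.
by rewrite mxtrace_diag; apply: eq_bigr => i _; rewrite mxE.
Qed.

Lemma center_form_class_sum (gT : finGroupType) (G : {group gT})
    (K L : {set gT}) :
    K \in classes G -> L \in classes G ->
  center_form (gset_mx algC G K) (gset_mx algC G L) =
  \sum_(i : Iirr G) ('omega_i[gset_mx algC G K])^* * 'omega_i[gset_mx algC G L].
Proof.
move=> KG LG; have sKG : K \subset G.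
  by have /imsetP[x Gx ->] := KG; apply: class_subG.
have KVG : K^-1%g \in classes G.
  by have /imsetP[x Gx ->] := KG; rewrite -classVg mem_classes ?groupV.
have [ZK ZL] := (gset_mx_class_central algC KVG, gset_mx_class_central algC LG).
rewrite /center_form group_ring_bar_gset_mx // center_traceE; last first.
  exact: center_group_ringM.
by apply: eq_bigr => i _; rewrite gring_irr_modeM // gring_irr_mode_gset_inv.
Qed.

(** Serves to pass from the indexing of the classes by 'I_#|classes G| to the
    one by Iirr G, on which mode_table is defined. *)
Lemma gram_abs_det_cast (gT : finGroupType) (G : {group gT}) n m (e : m = n)
    (B : 'I_n -> 'M[algC]_#|G|) :
  gram_abs_det B = gram_abs_det (fun i : 'I_m => B (cast_ord e i)).
Proof.
case: n / e B => B; congr `|\det _|.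
by apply/matrixP=> i j; rewrite !mxE !cast_ord_id.
Qed.

Lemma class_gammaE (gT : finGroupType) (G : {group gT}) :
  class_gamma G = `|\det (mode_table G)| ^+ 2.
Proof.
rewrite /class_gamma (gram_abs_det_cast (NirrE G)) /gram_abs_det.
set M := \matrix_(i, j) _.
have -> : M = (map_mx Num.conj (mode_table G))^T *m mode_table G.
  apply/matrixP=> i j; rewrite !mxE center_form_class_sum ?irr_classP //.
  by apply: eq_bigr => k _; rewrite !mxE.
by rewrite det_mulmx det_tr det_map_mx normrM norm_conjC.
Qed.

Lemma class_gamma_harada (gT : finGroupType) (G : {group gT}) :
  class_gamma G = harada_number G ^+ 2 * (centralizer_product G)%:R.
Proof.
rewrite class_gammaE det_mode_table normrM exprMn normr_det_character_table.
congr (_ * _); rewrite real_normK // Creal_Crat //; exact: harada_number_rat.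
Qed.

(** A rational algebraic integer is an integer: rationality is read off the
    formula h(G)^2 c(G), algebraic integrality off the determinant of W. *)
Lemma class_gamma_int (gT : finGroupType) (G : {group gT}) :
  class_gamma G \in Num.int.
Proof.
apply: Cint_rat_Aint.
  rewrite class_gamma_harada rpredM ?rpredX ?harada_number_rat //.
  exact: rpred_nat.
rewrite class_gammaE normCK.
suff Adet : \det (mode_table G) \in Aint by rewrite rpredM // Aint_aut.
rewrite rpred_sum // => s _; rewrite rpredMsign rpred_prod // => i _.
by rewrite mxE; apply: (Aint_gring_mode_class_sum i (cast_ord (NirrE G) (s i))).
Qed.

Theorem theorem1p2 (gT : finGroupType) (G : {group gT}) :
  exists gamma : int,
    [/\ class_gamma G = gamma%:~R,
        class_gamma G = harada_number G ^+ 2 * (centralizer_product G)%:R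
      & harada_number G \in Num.int <->
        ((centralizer_product G)%:Z %| gamma)%Z].
Proof.
have /intrP[gamma gammaE] := class_gamma_int G.
have hE := class_gamma_harada G.
exists gamma; split=> //; split=> [/intrP[h defh] | /dvdzP[q defq]].
  apply/dvdzP; exists (h ^+ 2); apply: (@intr_inj algC).
  by rewrite -gammaE hE defh rmorphM rmorphXn.
have h2q : harada_number G ^+ 2 = q%:~R.
  apply: (mulIf (x := (centralizer_product G)%:R)).
    by rewrite pnatr_eq0 -lt0n prodn_gt0 // => K; apply: cardG_gt0.
  by rewrite -hE gammaE defq rmorphM.
apply: Cint_rat_Aint (harada_number_rat G) _.
apply: (@root_monic_Aint ('X^2 - q%:~R%:P)).
- by rewrite rootE !hornerE h2q subrr.
- exact: monicXnsubC.
by rewrite polyOverXnsubC rpred_int.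
Qed.
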